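(* Let $\Theta=\{1,2\}$ and let $P_1,\dots,P_m$ be experiments ($P_i:\Theta\to\Delta(Y_i)$, $Y_i$ finite) such that $w(P_1)>\max\{w(P_i):i\ne1\}$. Then for every decision problem $(A,u)$ there exists $t^*$ such that for all integers $t\ge t^*$, $$V(P_1^t,\dots,P_m^t;(A,u))=V(P_1^t;(A,u)).$$
   Context: A decision problem is a pair $(A,u)$ with $A$ a finite nonempty action set and $u:\Theta\times A\to\mathbb{R}$; for $\alpha\in\Delta(A)$ write $u(\theta,\alpha)=\sum_a\alpha(a)u(\theta,a)$. An experiment is a map $P:\Theta\to\Delta(Y)$ with $Y$ a finite signal set. Given experiments $Q_j:\Theta\to\Delta(Z_j)$, $j=1,\dots,m$, let $\mathbf Z=Z_1\times\cdots\times Z_m$ and let $\mathcal P(Q_1,\dots,Q_m)$ be the set of experiments $Q:\Theta\to\Delta(\mathbf Z)$ whose $j$-th marginal is $Q_j(\cdot|\theta)$ for every $\theta$ and $j$. Define $V(Q_1,\dots,Q_m;(A,u))=\max_{\sigma:\mathbf Z\to\Delta(A)}\min_{Q\in\mathcal P(Q_1,\dots,Q_m)}\sum_{\theta}\sum_{\mathbf z}Q(\mathbf z|\theta)u(\theta,\sigma(\mathbf z))$; for a single experiment, $V(Q;(A,u))=\max_{\sigma:Z\to\Delta(A)}\sum_\theta\sum_z Q(z|\theta)u(\theta,\sigma(z))$. For an experiment $P:\Theta\to\Delta(Y)$ and integer $t\ge1$, $P^t:\Theta\to\Delta(Y^t)$ is the experiment of $t$ i.i.d. draws: $P^t(y_1,\dots,y_t|\theta)=\prod_{\tau=1}^tP(y_\tau|\theta)$.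 For an experiment $P$ with $\Theta=\{1,2\}$, $w(P)$ denotes the Chernoff distance between $P(\cdot|1)$ and $P(\cdot|2)$: $w(P)=-\min_{s\in[0,1]}\log\sum_{y\in Y}P(y|1)^sP(y|2)^{1-s}$, equivalently $w(P)=\min_{\nu\in\Delta(Y)}\max_{\theta\in\Theta}KL(\nu,P(\cdot|\theta))$ where $KL(\nu,\nu')=\sum_y\nu(y)\log\frac{\nu(y)}{\nu'(y)}$. *)

(* Defs.v *)
From HB Require Import structures.
From mathcomp Require Import all_boot all_order all_algebra.
From mathcomp Require Import all_classical all_reals all_analysis.
Set Implicit Arguments. Unset Strict Implicit. Unset Printing Implicit Defensive.
Import Order.TTheory GRing.Theory Num.Theory.
Local Open Scope ring_scope.
Local Open Scope classical_set_scope.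

Definition is_dist (R : realType) (T : finType) (p : T -> R) : Prop :=
  (forall x, 0 <= p x) /\ \sum_(x : T) p x = 1.

Definition experiment (R : realType) (Th Y : finType) := Th -> Y -> R.

Definition is_experiment (R : realType) (Th Y : finType)
  (P : experiment R Th Y) : Prop := forall th, is_dist (P th).

Definition mix_payoff (R : realType) (Th A : finType) (u : Th -> A -> R)
  (th : Th) (al : A -> R) : R := \sum_(a : A) al a * u th a.

Definition is_strategy (R : realType) (Z A : finType) (s : Z -> A -> R) : Prop :=
  forall z, is_dist (s z).

Definition payoff (R : realType) (Th Z A : finType) (u : Th -> A -> R)
  (Q : experiment R Th Z) (s : Z -> A -> R) : R :=
  \sum_(th : Th) \sum_(z : Z) Q th z * mix_payoff u th (s z).

(* V(Q;(A,u)) for a single experiment (the max is attained; sup = max). *)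
Definition V1 (R : realType) (Th Z A : finType) (u : Th -> A -> R)
  (Q : experiment R Th Z) : R :=
  sup [set payoff u Q s | s in @is_strategy R Z A].

Definition jointT (m : nat) (Z : 'I_m -> finType) : finType :=
  {dffun forall j : 'I_m, Z j}.

Definition has_marginals (R : realType) (Th : finType) (m : nat)
  (Z : 'I_m -> finType) (Qs : forall j, experiment R Th (Z j))
  (Q : experiment R Th (jointT Z)) : Prop :=
  is_experiment Q /\
  forall (th : Th) (j : 'I_m) (zj : Z j),
    \sum_(z : jointT Z | z j == zj) Q th z = Qs j th zj.

(* V(Q_1,...,Q_m;(A,u)) = max_sigma min_{Q in P(Q_1..Q_m)} ... (as sup/inf,
   which are attained). *)
Definition Vjoint (R : realType) (Th A : finType) (m : nat)
  (Z : 'I_m -> finType) (u : Th -> A -> R)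
  (Qs : forall j, experiment R Th (Z j)) : R :=
  sup [set inf [set payoff u Q s | Q in has_marginals Qs]
      | s in @is_strategy R (jointT Z) A].

Definition iid (R : realType) (Th Y : finType) (P : experiment R Th Y) (t : nat)
  : experiment R Th {ffun 'I_t -> Y} :=
  fun th ys => \prod_(k < t) P th (ys k).
Arguments iid [R Th Y] P t _ _.

Definition elog (R : realType) (x : R) : \bar R :=
  if x == 0 then -oo%E else (ln x)%:E.

(* Chernoff distance between P(.|1) and P(.|2), Theta = {1,2} = 'I_2
   (1 ~ ord0, 2 ~ ord_max); value in [0, +oo] (+oo for mutually singular). *)
Definition chernoff_distance (R : realType) (Y : finType) (P : experiment R 'I_2 Y)
  : \bar R :=
  (- ereal_inf [set elog (\sum_(y : Y) (P ord0 y `^ s) * (P ord_max y `^ (1 - s)))%R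
               | s in [set s : R | (0 <= s <= 1)%R]])%E.

(* Main.v *)
(* Let o(P) = \sum_y min(P(y|1), P(y|2)) be the overlap of an experiment.  It
   decays like exp(- t w(P)) along P^t, so for any constant M the overlap of
   P_1^t is eventually less than 1/M times that of every other P_j^t.  (For the
   lower bound on the overlap, tilt to q proportional to P(.|1)^s P(.|2)^(1-s)
   with s the critical point; the log-likelihood ratio L of t draws is then
   centred under q up to a harmless sign, and Jensen's inequality for exp(- |L|)
   together with Var L = O(t) costs only a subexponential factor.)

   Split each signal y of P_1^t into a "common" part with masses
   (min(x1, M x2), min(x2, M x1)), where xi = P_1^t(y|i), and a "revealing" part
   of mass in a single state only.  If M is large, a single action is optimal on
   the whole cone x1 >= M x2, and likewise on x2 >= M x1, so the splitting does
   not raise the value of P_1^t.  The common part has mass at most M o(P_1^t),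
   hence is below the overlap of every P_j^t; so P_j^t can be obtained from the
   split experiment by drawing the j-th signal from the normalised minimum of
   its two laws on the common part, and from the residual law of the revealed
   state otherwise.  The joint experiment so obtained is worth no more than
   P_1^t, while ignoring the other signals guarantees the value of P_1^t. *)
Require Import Defs.
From HB Require Import structures.
From mathcomp Require Import all_boot all_order all_algebra.
From mathcomp Require Import all_classical all_reals all_analysis.
From mathcomp Require Import ring lra.
Set Implicit Arguments.
Unset Strict Implicit.
Unset Printing Implicit Defensive.
Import Order.TTheory GRing.Theory Num.Theory.
Import numFieldNormedType.Exports.
Local Open Scope ring_scope.
Local Open Scope classical_set_scope.

(** * Sums over dependent products *)

Lemma sum_dffun_prod (R : comPzRingType) (I : finType) (T : I -> finType)
  (F : forall i, T i -> R) :
  \sum_(z : {dffun forall i : I, T i}) \prod_(i : I) F i (z i) =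
  \prod_(i : I) \sum_(y : T i) F i y.
Proof.
rewrite (reindex (@dffun_of_fprod I T)) /=; last first.
  by exists (@fprod_of_dffun I T) => t _;
    rewrite ?dffun_of_fprodK ?fprod_of_dffunK.
pose G i : {ffun T i -> R} := [ffun y => F i y].
transitivity (\sum_(t : fprod T) \prod_(i in I) G i (t i)).
  by apply: eq_bigr => t _; apply: eq_bigr => i _; rewrite !ffunE.
rewrite big_fprod; symmetry.
rewrite -(bigA_distr_big_dep (tagged_with T) (fun i => untag 0 (G i))) /=.
apply: eq_bigr => i _.
transitivity (\sum_(y : T i) G i y).
  by apply: eq_bigr => y _; rewrite ffunE.
exact: (big_tag (fun i => G i)).
Qed.

(** An indicator inside the factor at [j] absorbs the constraint on [z j]. It compares through
    [Tagged], since [x] and [y] have the same type only when [i] is [j]. *)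
Lemma sum_dffun_prod_marginal (R : comPzRingType) (I : finType)
  (T : I -> finType) (F : forall i, T i -> R) (j : I) (y : T j) :
  \sum_(z : {dffun forall i : I, T i} | z j == y) \prod_(i : I) F i (z i) =
  F j y * \prod_(i | i != j) \sum_(x : T i) F i x.
Proof.
pose G i (x : T i) := F i x * ((i == j) ==> (Tagged T x == Tagged T y))%:R.
have Gj (x : T j) : G j x = F j x * (x == y)%:R.
  by rewrite /G eqxx /= eq_Tagged.
have Gi i (x : T i) : i != j -> G i x = F i x.
  by move=> ij; rewrite /G (negbTE ij) mulr1.
have sumGj : \sum_x G j x = F j y.
  rewrite (bigD1 y) //= Gj eqxx mulr1 big1 ?addr0 // => x xy.
  by rewrite Gj (negbTE xy) mulr0.
transitivity (\prod_i \sum_x G i x); last first.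
  rewrite (bigD1 j) //= sumGj; congr (_ * _).
  by apply: eq_bigr => i ij; apply: eq_bigr => x _; rewrite Gi.
rewrite -sum_dffun_prod big_mkcond; apply: eq_bigr => z _.
rewrite [RHS](bigD1 j) //= Gj [X in if _ then X else _](bigD1 j) //=.
case: eqP => _; last by rewrite mulr0 mul0r.
by rewrite mulr1; congr (_ * _); apply: eq_bigr => i ij; rewrite Gi.
Qed.

Lemma sum_I2 (V : nmodType) (F : 'I_2 -> V) :
  \sum_(th : 'I_2) F th = F ord0 + F ord_max.
Proof.
by rewrite big_ord_recl big_ord1; congr (_ + F _); apply: val_inj.
Qed.

Lemma I2P (th : 'I_2) : th = ord0 \/ th = ord_max.
Proof.
by case: th => [[|[|//]]] lt2; [left|right]; apply: val_inj.
Qed.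

Lemma exists_max_action (R : realType) (A : finType) (f : A -> R) :
  (0 < #|A|)%N -> exists a, forall b, f b <= f a.
Proof.
case/card_gt0P => a0 _.
by case: (@arg_maxP _ R A a0 xpredT f) => // a _ aP; exists a => b; apply: aP.
Qed.

(** This lemma and the next two give the marginals and the mass of a product with [k] at [j0] and
    normalised weights [F i] elsewhere. *)
Lemma sum_based_prod_base (R : comPzRingType) (I : finType)
  (T : I -> finType) (j0 : I) (k : T j0 -> R) (F : forall i, T i -> R) (y : T j0) :
  (forall i, i != j0 -> \sum_x F i x = 1) ->
  \sum_(z : {dffun forall i : I, T i} | z j0 == y)
    k (z j0) * \prod_(i | i != j0) F i (z i) = k y.
Proof.
move=> F1; pose H i (x : T i) := if i == j0 then 1 else F i x.
transitivity (k y * \sum_(z : {dffun forall i : I, T i} | z j0 == y)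
    \prod_i H i (z i)).
  rewrite mulr_sumr; apply: eq_bigr => z /eqP ->; congr (_ * _).
  rewrite [RHS](bigD1 j0) //= /H eqxx mul1r.
  by apply: eq_bigr => i /negbTE ->.
rewrite sum_dffun_prod_marginal /H eqxx big1 ?mulr1 // => i ij.
by rewrite (negbTE ij) F1.
Qed.

Lemma sum_based_prod (R : comPzRingType) (I : finType)
  (T : I -> finType) (j0 : I) (k : T j0 -> R) (F : forall i, T i -> R) :
  (forall i, i != j0 -> \sum_x F i x = 1) ->
  \sum_(z : {dffun forall i : I, T i})
    k (z j0) * \prod_(i | i != j0) F i (z i) = \sum_x k x.
Proof.
move=> F1; rewrite (partition_big (fun z : {dffun _} => z j0) xpredT) //=.
by apply: eq_bigr => y _; rewrite sum_based_prod_base.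
Qed.

Lemma sum_based_prod_other (R : comPzRingType) (I : finType)
  (T : I -> finType) (j0 j : I) (k F : forall i, T i -> R) (y : T j) :
  (forall i, i != j0 -> \sum_x F i x = 1) -> j != j0 ->
  \sum_(z : {dffun forall i : I, T i} | z j == y)
    k j0 (z j0) * \prod_(i | i != j0) F i (z i) = (\sum_x k j0 x) * F j y.
Proof.
move=> F1 jj0; pose H i (x : T i) := if i == j0 then k i x else F i x.
transitivity (\sum_(z : {dffun forall i : I, T i} | z j == y)
    \prod_i H i (z i)).
  apply: eq_bigr => z _; rewrite [RHS](bigD1 j0) //= /H eqxx; congr (_ * _).
  by apply: eq_bigr => i /negbTE ->.
rewrite sum_dffun_prod_marginal (bigD1 j0) ?(eq_sym j0) //=.
rewrite [X in _ * (_ * X)]big1 => [|i /andP[_ i0]].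
  by rewrite mulr1 /H eqxx (negbTE jj0) mulrC.
by rewrite /H (negbTE i0) F1.
Qed.

(** * The coupling *)

(* The lexicographically best action [a]: any other action that is better in
   the second state is strictly worse in the first, so [f] outweighs [g] once
   scaled by a large [M]. *)
Lemma lexicographic_best_action (R : realType) (A : finType) (f g : A -> R) :
  (0 < #|A|)%N ->
  exists a M0, forall M, M0 <= M ->
    forall b, f b <= f a /\ M * f b + g b <= M * f a + g a.
Proof.
move=> A0; have [a1 a1P] := exists_max_action f A0.
have [a0 /eqP fa0 a0P] := @arg_maxP _ R A a1 (fun b => f b == f a1) g (eqxx _).
have fle b : f b <= f a0 by rewrite fa0.
exists a0, (\sum_b `|(g b - g a0) / (f a0 - f b)|) => M M0 b; split => //.
have [fb|fb] := eqVneq (f b) (f a1).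
  rewrite fb fa0 lerD2l; apply: a0P; exact/eqP.
have d0 : 0 < f a0 - f b by rewrite subr_gt0 lt_neqAle fa0 fb -fa0 fle.
have : (g b - g a0) / (f a0 - f b) <= M.
  apply: le_trans M0; apply: le_trans (ler_norm _) _.
  by rewrite (bigD1 b) //= lerDl; apply: sumr_ge0.
rewrite ler_pdivrMr //; lra.
Qed.

(** [C] bounds the yield of the common part of a signal with masses [(x, y)]; [D0] and [D1] bound
    that of a revealed state. If [x > M * y], the common part lies on the ray [(M, 1)], where the
    lexicographically best action is optimal, and this action also attains [D0] on the excess. The
    other side is symmetric, and between the rays nothing is split off. *)
Lemma ray_splitting (R : realType) (A : finType) (f g : A -> R) :
  (0 < #|A|)%N ->
  exists M D0 D1, [/\ 1 <= M, forall a, f a <= D0, forall a, g a <= D1 &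
    forall x y, 0 <= x -> 0 <= y -> exists b C,
      (forall a, Num.min x (M * y) * f a + Num.min y (M * x) * g a <= C) /\
      C + (x - Num.min x (M * y)) * D0 + (y - Num.min y (M * x)) * D1
        <= x * f b + y * g b].
Proof.
move=> A0.
have [a [Ma aP]] := lexicographic_best_action f g A0.
have [b [Mb bP]] := lexicographic_best_action g f A0.
pose M := Num.max 1 (Num.max Ma Mb).
have M1 : 1 <= M by rewrite le_max lexx.
have {}aP := aP M _; have {}bP := bP M _.
have aM : Ma <= M by rewrite !le_max lexx orbT.
have bM : Mb <= M by rewrite !le_max lexx !orbT.
exists M, (f a), (g b); split => // [c|c|x y x0 y0].
- by have [] := aP aM c.
- by have [] := bP bM c.
have [yx|xy] := ltP (M * y) x.
  have -> : Num.min y (M * x) = y by apply/min_idPl; nra.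
  exists a, (M * y * f a + y * g a); split => [c|]; last by lra.
  by have [_ ] := aP aM c; nra.
have [yx|yx] := ltP (M * x) y.
  exists b, (x * f b + M * x * g b); split => [c|]; last by lra.
  by have [_ ] := bP bM c; nra.
have [c cP] := exists_max_action (fun a => x * f a + y * g a) A0.
by exists c, (x * f c + y * g c); split => //; lra.
Qed.

Definition overlap (R : realType) (Y : finType) (P : experiment R 'I_2 Y) : R :=
  \sum_y Num.min (P ord0 y) (P ord_max y).

Lemma overlap_le1 (R : realType) (Y : finType) (P : experiment R 'I_2 Y) :
  is_experiment P -> overlap P <= 1.
Proof.
move=> eP; rewrite -(eP ord0).2; apply: ler_sum => y _.
by rewrite ge_min lexx.
Qed.

Lemma mix_payoff_norm_le (R : realType) (Th A : finType) (u : Th -> A -> R) th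
  (al : A -> R) : is_dist al -> `|mix_payoff u th al| <= \sum_a `|u th a|.
Proof.
move=> [al0 al1]; rewrite /mix_payoff.
apply: (le_trans (ler_norm_sum _ _ _)); apply: ler_sum => a _.
rewrite normrM ler_piMl // ger0_norm // -al1 (bigD1 a) //= lerDl.
exact: sumr_ge0.
Qed.

Lemma payoff_norm_le (R : realType) (Th Z A : finType) (u : Th -> A -> R)
  (Q : experiment R Th Z) (s : Z -> A -> R) :
  is_experiment Q -> is_strategy s ->
  `|payoff u Q s| <= \sum_th \sum_a `|u th a|.
Proof.
move=> eQ ss; rewrite /payoff.
apply: (le_trans (ler_norm_sum _ _ _)); apply: ler_sum => th _.
apply: (le_trans (ler_norm_sum _ _ _)).
have [Q0 Q1] := eQ th.
rewrite -[leRHS]mul1r -Q1 mulr_suml; apply: ler_sum => z _.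
rewrite normrM ger0_norm //; apply: ler_wpM2l => //.
exact: mix_payoff_norm_le.
Qed.

Lemma mix_payoff_linear_le (R : realType) (A : finType) (f g : A -> R) (al : A -> R)
  (x y C : R) : is_dist al -> (forall a, x * f a + y * g a <= C) ->
  x * (\sum_a al a * f a) + y * (\sum_a al a * g a) <= C.
Proof.
move=> [al0 al1] fg; rewrite -[C]mul1r -al1 !mulr_sumr mulr_suml -big_split /=.
apply: ler_sum => a _; have := ler_wpM2l (al0 a) (fg a); lra.
Qed.

Lemma mix_payoff_le (R : realType) (Th A : finType) (u : Th -> A -> R) th
  (al : A -> R) (C : R) : is_dist al -> (forall a, u th a <= C) ->
  mix_payoff u th al <= C.
Proof.
move=> dal uC; have := @mix_payoff_linear_le R A (u th) (u th) al 1 0 C dal.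
by rewrite mul1r mul0r addr0; apply => a; rewrite mul1r mul0r addr0.
Qed.

Section Coupling.
Variables (R : realType) (m : nat) (Z : 'I_m.+1 -> finType).
Variables (P : forall i : 'I_m.+1, experiment R 'I_2 (Z i)) (M : R).
Arguments P : clear implicits.
Hypothesis eP : forall i, is_experiment (P i).
Hypothesis M1 : 1 <= M.
Hypothesis dominated :
  forall j : 'I_m.+1, j != ord0 -> M * overlap (P ord0) < overlap (P j).

Let other (th : 'I_2) : 'I_2 := if th == ord0 then ord_max else ord0.
Let common th i (y : Z i) : R := Num.min (P i th y) (M * P i (other th) y).
Let commonM th : R := \sum_y @common th ord0 y.
Let nu i (y : Z i) : R := Num.min (P i ord0 y) (P i ord_max y) / overlap (P i).
(** The law [P i th] with mass [commonM th] of [nu] taken out, normalised. *)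
Let rho th i (y : Z i) : R :=
  (P i th y - commonM th * nu y) / (1 - commonM th).

(* With probability [commonM th] all signals but the first are drawn from the
   state-independent laws [nu], otherwise from the residual laws [rho]. *)
Definition coupling : experiment R 'I_2 (jointT Z) := fun th z =>
  common th (z ord0) * \prod_(i | i != ord0) nu (z i) +
  (P ord0 th (z ord0) - common th (z ord0)) * \prod_(i | i != ord0) rho th (z i).

Let P_ge0 i th y : 0 <= P i th y.
Proof. exact: (eP i th).1. Qed.

Let minP_ge0 i y : 0 <= Num.min (P i ord0 y) (P i ord_max y).
Proof. by rewrite le_min !P_ge0. Qed.

Let minP_le i th y : Num.min (P i ord0 y) (P i ord_max y) <= P i th y.
Proof. by case: (I2P th) => ->; rewrite ge_min lexx ?orbT. Qed.

Let common_ge0 th i (y : Z i) : 0 <= common th y.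
Proof. by rewrite le_min P_ge0 mulr_ge0 // (le_trans ler01). Qed.

Let common_le th i (y : Z i) : common th y <= P i th y.
Proof. by rewrite ge_min lexx. Qed.

(** As [M >= 1], min(p, M q) is at most min(M p, M q). *)
Let common_le_overlap th i (y : Z i) :
  common th y <= M * Num.min (P i ord0 y) (P i ord_max y).
Proof.
have M0 := le_trans ler01 M1.
have := P_ge0 ord0 y; have := P_ge0 ord_max y; rewrite /common /other.
case: (I2P th) => -> /=; rewrite (minr_pMr _ _ M0) => p q.
  by rewrite le_min !ge_min lexx orbT andbT ler_peMl.
by rewrite le_min !ge_min lexx orbT /= ler_peMl.
Qed.

Let commonM_lt th (j : 'I_m.+1) : j != ord0 -> commonM th < overlap (P j).
Proof.
move=> j0; apply: le_lt_trans (dominated j0).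
by rewrite /overlap mulr_sumr; apply: ler_sum => y _; exact: common_le_overlap.
Qed.

Let commonM_ge0 th : 0 <= commonM th.
Proof. by apply: sumr_ge0 => y _; exact: common_ge0. Qed.

Let residual_gt0 th (j : 'I_m.+1) : j != ord0 -> 0 < 1 - commonM th.
Proof.
move=> j0; rewrite subr_gt0; apply: lt_le_trans (commonM_lt th j0) _.
exact: overlap_le1.
Qed.

Let nu_ge0 i (y : Z i) : 0 <= nu y.
Proof. by rewrite divr_ge0 // sumr_ge0. Qed.

Let sum_nu (j : 'I_m.+1) : j != ord0 -> \sum_y @nu j y = 1.
Proof.
move=> j0; rewrite -mulr_suml divff // gt_eqF //.
by apply: le_lt_trans (commonM_lt ord0 j0).
Qed.

Let sum_rho th (j : 'I_m.+1) : j != ord0 -> \sum_y @rho th j y = 1.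
Proof.
move=> j0; rewrite -mulr_suml big_split /= sumrN -mulr_sumr sum_nu // mulr1.
by rewrite (eP j th).2 divff // gt_eqF // (residual_gt0 th j0).
Qed.

(** Since [commonM th] is below the overlap, the mass removed at [y] is at most the minimum of the
    two laws there. *)
Let rho_ge0 th (j : 'I_m.+1) (y : Z j) : j != ord0 -> 0 <= rho th y.
Proof.
move=> j0; rewrite divr_ge0 ?(ltW (residual_gt0 th j0)) // subr_ge0.
apply: le_trans (minP_le th y); rewrite mulrCA ler_piMr //.
have o0 : 0 < overlap (P j) by apply: le_lt_trans (commonM_lt th j0).
by rewrite ler_pdivrMr // mul1r ltW // commonM_lt.
Qed.

(** At [ord0] the common and revealed masses add up again; at any other [j] the weights [commonM th]
    and [1 - commonM th] mix [nu] and [rho] back into [P j]. *)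
Lemma coupling_marginals : has_marginals P coupling.
Proof.
have marg th j y : \sum_(z : jointT Z | z j == y) coupling th z = P j th y.
  have [j0|j0] := eqVneq j ord0.
    subst j; rewrite big_split /= (sum_based_prod_base (@common th ord0) y sum_nu).
    rewrite (sum_based_prod_base (fun y => P ord0 th y - common th y) y (sum_rho th)).
    by rewrite addrC subrK.
  rewrite big_split /= (sum_based_prod_other (@common th) y sum_nu j0).
  rewrite (sum_based_prod_other (fun i y => P i th y - common th y) y (sum_rho th) j0).
  rewrite big_split /= sumrN (eP _ th).2 -/(commonM th) /rho [X in _ + X]mulrC.
  by rewrite divfK ?gt_eqF ?(residual_gt0 th j0) // addrC subrK.
split=> // th; split=> [z|].
  rewrite addr_ge0 // mulr_ge0 ?subr_ge0 // prodr_ge0 // => i i0.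
  exact: rho_ge0.
rewrite (partition_big (fun z : jointT Z => z ord0) xpredT) //=.
by rewrite -(eP ord0 th).2; apply: eq_bigr => y _; exact: marg.
Qed.

(** Given the first signal, the others carry no information on the common part, so [C] bounds its
    yield under any strategy; on the revealed part no action beats [D th]. The other signals then
    sum out to one. *)
Lemma payoff_coupling_le (A : finType) (u : 'I_2 -> A -> R) (D : 'I_2 -> R)
  (C : Z ord0 -> R) (s : jointT Z -> A -> R) :
  is_strategy s -> (forall th a, u th a <= D th) ->
  (forall y a,
    Num.min (P ord0 ord0 y) (M * P ord0 ord_max y) * u ord0 a +
    Num.min (P ord0 ord_max y) (M * P ord0 ord0 y) * u ord_max a <= C y) ->
  payoff u coupling s <= \sum_y (C y +
    (P ord0 ord0 y - Num.min (P ord0 ord0 y) (M * P ord0 ord_max y)) * D ord0 +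
    (P ord0 ord_max y - Num.min (P ord0 ord_max y) (M * P ord0 ord0 y)) * D ord_max).
Proof.
move=> ss uD uC.
pose N (F : forall i, Z i -> R) (z : jointT Z) := \prod_(i | i != ord0) F i (z i).
have cl th y : 0 <= P ord0 th y - common th y by rewrite subr_ge0.
rewrite /payoff sum_I2 -big_split /=.
apply: (@le_trans _ _ (\sum_(z : jointT Z) (C (z ord0) * N nu z +
   ((P ord0 ord0 (z ord0) - common ord0 (z ord0)) * D ord0) * N (rho ord0) z +
   ((P ord0 ord_max (z ord0) - common ord_max (z ord0)) * D ord_max) *
     N (rho ord_max) z))).
  apply: ler_sum => z _; rewrite /coupling -!/(N _ z).
  have nu0 : 0 <= N nu z by apply: prodr_ge0.
  have rho0 th : 0 <= N (rho th) z.
    by apply: prodr_ge0 => i i0; exact: rho_ge0.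
  have h1 := ler_wpM2l nu0 (mix_payoff_linear_le (ss z) (uC (z ord0))).
  have h2 th := ler_wpM2l (mulr_ge0 (cl th (z ord0)) (rho0 th))
    (mix_payoff_le (ss z) (uD th)).
  have h20 := h2 ord0; have h21 := h2 ord_max; move: h1 h20 h21.
  rewrite -!/(mix_payoff _ _ _) /common /other /=.
  set m0 := Num.min _ _; set m1 := Num.min _ _.
  lra.
rewrite !big_split /= /N (sum_based_prod C sum_nu).
rewrite (sum_based_prod
  (fun y => (P ord0 ord0 y - common ord0 y) * D ord0) (sum_rho ord0)).
by rewrite (sum_based_prod
  (fun y => (P ord0 ord_max y - common ord_max y) * D ord_max) (sum_rho ord_max)).
Qed.

End Coupling.

(** * Equality of values under overlap domination *)

Lemma is_dist_delta (R : realType) (A : finType) (a : A) :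
  is_dist (fun b => (b == a)%:R : R).
Proof.
split=> [b|]; first exact: ler0n.
by rewrite (bigD1 a) //= eqxx big1 ?addr0 // => b /negbTE ->.
Qed.

Lemma mix_payoff_delta (R : realType) (Th A : finType) (u : Th -> A -> R) th a :
  mix_payoff u th (fun b => (b == a)%:R) = u th a.
Proof.
rewrite /mix_payoff (bigD1 a) //= eqxx mul1r big1 ?addr0 // => b /negbTE ->.
by rewrite mul0r.
Qed.

Lemma payoff_le_V1 (R : realType) (Th Z A : finType) (u : Th -> A -> R)
  (Q : experiment R Th Z) (s : Z -> A -> R) :
  is_experiment Q -> is_strategy s -> payoff u Q s <= V1 u Q.
Proof.
move=> eQ ss; apply: ub_le_sup; last by exists s.
exists (\sum_th \sum_a `|u th a|) => _ [s' ss' <-].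
exact: le_trans (ler_norm _) (payoff_norm_le _ eQ ss').
Qed.

Lemma payoff_coordinate (R : realType) (Th A : finType) (m : nat)
  (Z : 'I_m -> finType) (u : Th -> A -> R) (Qs : forall j, experiment R Th (Z j))
  (Q : experiment R Th (jointT Z)) (j : 'I_m) (s : Z j -> A -> R) :
  has_marginals Qs Q -> payoff u Q (fun z => s (z j)) = payoff u (Qs j) s.
Proof.
move=> [_ mQ]; rewrite /payoff; apply: eq_bigr => th _.
rewrite (partition_big (fun z : jointT Z => z j) xpredT) //=.
apply: eq_bigr => y _; rewrite -mQ mulr_suml.
by apply: eq_bigr => z /eqP ->.
Qed.

(** [M] comes from the payoffs alone, so a single [M] serves every sample size. The upper bound
    tests each strategy against [coupling]; the lower bound uses strategies that read only the first
    signal. *)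
Lemma Vjoint_eq_V1 (R : realType) (A : finType) (u : 'I_2 -> A -> R) :
  (0 < #|A|)%N -> exists M : R, forall (m : nat) (Z : 'I_m.+1 -> finType)
    (P : forall i : 'I_m.+1, experiment R 'I_2 (Z i)),
  (forall i, is_experiment (P i)) ->
  (forall j : 'I_m.+1, j != ord0 -> M * overlap (P ord0) < overlap (P j)) ->
  Vjoint u P = V1 u (P ord0).
Proof.
move=> A0; have [a0 _] := card_gt0P A0.
have [M [D0 [D1 [M1 uD0 uD1 split_le]]]] := ray_splitting (u ord0) (u ord_max) A0.
exists M => m Z P eP dom.
have mQ := coupling_marginals eP M1 dom.
set Q := coupling P M in mQ.
have lb s : is_strategy s ->
    has_lbound [set payoff u Q' s | Q' in has_marginals P].
  move=> ss; exists (- \sum_th \sum_a `|u th a|) => _ [Q' [eQ' _] <-].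
  by have := payoff_norm_le u eQ' ss; rewrite ler_norml => /andP[].
have /choice[bC bCP] : forall y, exists bC : A * R,
 (forall a, Num.min (P ord0 ord0 y) (M * P ord0 ord_max y) * u ord0 a +
  Num.min (P ord0 ord_max y) (M * P ord0 ord0 y) * u ord_max a <= bC.2) /\
 bC.2 + (P ord0 ord0 y - Num.min (P ord0 ord0 y) (M * P ord0 ord_max y)) * D0 +
 (P ord0 ord_max y - Num.min (P ord0 ord_max y) (M * P ord0 ord0 y)) * D1 <=
 P ord0 ord0 y * u ord0 bC.1 + P ord0 ord_max y * u ord_max bC.1.
  move=> y; have [b [C bC]] :=
    split_le _ _ ((eP ord0 ord0).1 y) ((eP ord0 ord_max).1 y).
  by exists (b, C).
have le_V1 s : is_strategy s -> payoff u Q s <= V1 u (P ord0).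
  move=> ss.
  (* The response to [y] is the action supplied by [ray_splitting]. *)
  pose s0 (y : Z ord0) (a : A) : R := (a == (bC y).1)%:R.
  apply: le_trans (payoff_le_V1 u (eP ord0) (s := s0) _); last first.
    by move=> y; exact: is_dist_delta.
  pose D (th : 'I_2) := if th == ord0 then D0 else D1.
  have uD th a : u th a <= D th by case: (I2P th) => ->; rewrite /D /=.
  apply: le_trans (payoff_coupling_le eP M1 dom ss uD
    (fun y => (bCP y).1)) _.
  rewrite /payoff sum_I2 -big_split /=; apply: ler_sum => y _.
  by rewrite !mix_payoff_delta; exact: (bCP y).2.
have inf_le s : is_strategy s ->
    inf [set payoff u Q' s | Q' in has_marginals P] <= V1 u (P ord0).
  move=> ss; apply: le_trans (le_V1 s ss); apply: ge_inf; first exact: lb.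
  by exists Q.
have delta_strategy (T : finType) :
    is_strategy (fun (_ : T) b => (b == a0)%:R : R).
  by move=> z; exact: is_dist_delta.
apply/eqP; rewrite eq_le; apply/andP; split.
  apply: ge_sup; last by move=> _ [s ss <-]; exact: inf_le.
  by eexists; exists (fun _ b => (b == a0)%:R); first exact: delta_strategy.
apply: ge_sup.
  by eexists; exists (fun _ b => (b == a0)%:R); first exact: delta_strategy.
move=> _ [s0 ss0 <-]; apply: ub_le_sup.
  by exists (V1 u (P ord0)) => _ [s ss <-]; exact: inf_le.
exists (fun z : jointT Z => s0 (z ord0)); first by move=> z; exact: ss0.
(* Every admissible joint experiment gives this strategy the same payoff, so the infimum is over a
   singleton; [Q] shows that the set is not empty. *)
rewrite -(inf1 (payoff u (P ord0) s0)); congr inf; apply/seteqP.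
split=> [_ [Q' mQ' <-]|_ ->].
  exact: payoff_coordinate.
by exists Q => //; exact: payoff_coordinate.
Qed.

(** * Chernoff asymptotics of the overlap *)

Lemma sum_iid_prod (R : comPzRingType) (T : finType) (F : T -> R) (t : nat) :
  \sum_(ys : {ffun 'I_t -> T}) \prod_(k < t) F (ys k) = (\sum_y F y) ^+ t.
Proof.
by rewrite -(bigA_distr_bigA (fun _ : 'I_t => F)) prodr_const card_ord.
Qed.

Lemma is_experiment_iid (R : realType) (Th Y : finType) (P : experiment R Th Y) t :
  is_experiment P -> is_experiment (iid P t).
Proof.
move=> eP th; split=> [ys|]; first by apply: prodr_ge0 => k _; exact: (eP th).1.
by rewrite sum_iid_prod (eP th).2 expr1n.
Qed.

Lemma min_le_powR (R : realType) (a b s : R) : 0 <= a -> 0 <= b -> 0 <= s <= 1 ->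
  Num.min a b <= a `^ s * b `^ (1 - s).
Proof.
move=> a0 b0 /andP[s0 s1]; set c := Num.min a b.
have [c0|c0] := leP c 0; first by rewrite (le_trans c0) // mulr_ge0 // powR_ge0.
have -> : c = c `^ s * c `^ (1 - s).
  by rewrite -powRD ?subrKC ?powRr1 ?oner_eq0 // ltW.
have c0' := ltW c0.
by apply: ler_pM; rewrite ?powR_ge0 // ge0_ler_powR // ?nnegrE ?subr_ge0 //
  /c ge_min lexx ?orbT.
Qed.

Lemma powR_prod (R : realType) (I : finType) (F : I -> R) (s : R) :
  (forall i, 0 <= F i) -> (\prod_i F i) `^ s = \prod_i (F i) `^ s.
Proof.
move=> F0.
suff : 0 <= \prod_i F i /\ (\prod_i F i) `^ s = \prod_i (F i) `^ s by case.
elim/big_rec2: _ => [|i x y _ [y0 yx]]; first by rewrite powR1.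
by rewrite mulr_ge0 // powRM // yx.
Qed.

(** The Chernoff upper bound: a weighted geometric mean dominates the minimum and factors over the
    draws. *)
Lemma overlap_iid_le (R : realType) (Y : finType) (P : experiment R 'I_2 Y) s t :
  is_experiment P -> 0 <= s <= 1 ->
  overlap (iid P t) <= (\sum_y P ord0 y `^ s * P ord_max y `^ (1 - s)) ^+ t.
Proof.
move=> eP s01; rewrite -sum_iid_prod; apply: ler_sum => ys _.
have P0 th y : 0 <= P th y by exact: (eP th).1.
by rewrite big_split /= -!powR_prod //; apply: min_le_powR => //; exact: prodr_ge0.
Qed.

(** The variance of a sum of independent centred terms: cross moments vanish. *)
Lemma sum_iid_square (R : comPzRingType) (T : finType) (q d : T -> R) (t : nat) :
  \sum_y q y = 1 -> \sum_y q y * d y = 0 ->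
  \sum_(ys : {ffun 'I_t -> T}) (\prod_(k < t) q (ys k)) * (\sum_(k < t) d (ys k)) ^+ 2
    = t%:R * \sum_y q y * d y ^+ 2.
Proof.
move=> q1 qd0.
(* Padding [d (ys i)] with ones turns each cross moment into a sum of products over the draws, which
   factors. *)
pose G (i k : 'I_t) (y : T) : R := if k == i then d y else 1.
have GE i (ys : {ffun 'I_t -> T}) : d (ys i) = \prod_k G i k (ys k).
  by rewrite (bigD1 i) //= /G eqxx big1 ?mulr1 // => k /negbTE ->.
have cross i j : \sum_(ys : {ffun 'I_t -> T}) (\prod_(k < t) q (ys k)) *
    (d (ys i) * d (ys j)) = if i == j then \sum_y q y * d y ^+ 2 else 0.
  under eq_bigr => ys _ do rewrite !GE -!big_split /=.
  rewrite -(bigA_distr_bigA (fun k y => q y * (G i k y * G j k y))) (bigD1 i) //=.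
  rewrite /G eqxx; case: eqP => [<-|ij].
    rewrite [X in _ * X]big1 ?mulr1 => [|k /negbTE ki]; last first.
      by under eq_bigr do rewrite ki !mulr1.
    by apply: eq_bigr.
  under [X in X * _]eq_bigr do rewrite mulr1.
  by rewrite qd0 mul0r.
under eq_bigr => ys _.
  rewrite expr2 mulr_suml mulr_sumr.
  under eq_bigr => i _ do rewrite !mulr_sumr.
  over.
rewrite exchange_big /=.
under eq_bigr => i _.
  rewrite exchange_big /=.
  under eq_bigr => j _ do rewrite cross eq_sym.
  rewrite -big_mkcond /= big_pred1_eq.
  over.
by rewrite sumr_const card_ord mulr_natl.
Qed.

(** The tangent of exp(-x) at the mean [E] lies below the curve and averages to exp(-E). *)
Lemma jensen_expRN (R : realType) (T : finType) (q X : T -> R) :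
  is_dist q -> expR (- \sum_y q y * X y) <= \sum_y q y * expR (- X y).
Proof.
move=> [q0 q1]; set E := \sum_y q y * X y.
have -> : expR (- E) = \sum_y q y * (expR (- E) * (1 + (E - X y))).
  transitivity (expR (- E) * \sum_y (q y * (1 + E) - q y * X y)).
    by rewrite big_split /= sumrN -mulr_suml q1 -/E mul1r addrK mulr1.
  by rewrite mulr_sumr; apply: eq_bigr => y _; ring.
apply: ler_sum => y _; apply: ler_wpM2l => //.
have -> : expR (- X y) = expR (- E) * expR (E - X y).
  by rewrite -expRD; congr expR; ring.
apply: ler_wpM2l; [exact: expR_ge0|exact: expR_ge1Dx].
Qed.

(* [D] is the deviation of [L] from its mean [t * mu]; the sign conditions on
   [mu] make both tilting exponents [(1 - s) L] and [- s L] at least [- |D|],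
   and [|D| <= eta D^2 + 1 / (4 eta)]. *)
Lemma tilted_overlap_ge (R : realType) (T : finType) (q l p0 p1 : T -> R)
  (c s eta : R) (t : nat) (mu := \sum_y q y * l y) :
  is_dist q -> 0 < c -> 0 <= s <= 1 -> s * mu <= 0 -> 0 <= (1 - s) * mu ->
  (forall y, c * q y * expR ((1 - s) * l y) <= p0 y) ->
  (forall y, c * q y * expR (- s * l y) <= p1 y) -> 0 < eta ->
  c ^+ t * expR (- (eta * (t%:R * \sum_y q y * (l y - mu) ^+ 2) + (4 * eta)^-1))
   <= \sum_(ys : {ffun 'I_t -> T})
        Num.min (\prod_(k < t) p0 (ys k)) (\prod_(k < t) p1 (ys k)).
Proof.
move=> dq c0 /andP[s0 s1] smu smu' p0P p1P eta0.
have [q0 q1] := dq.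
pose D (ys : {ffun 'I_t -> T}) := \sum_(k < t) (l (ys k) - mu).
pose X ys := eta * D ys ^+ 2 + (4 * eta)^-1.
pose q' (ys : {ffun 'I_t -> T}) := \prod_(k < t) q (ys k).
have dq' : is_dist q'.
  split=> [ys|]; first exact: prodr_ge0.
  by rewrite sum_iid_prod q1 expr1n.
have EX : \sum_ys q' ys * X ys =
    eta * (t%:R * \sum_y q y * (l y - mu) ^+ 2) + (4 * eta)^-1.
  rewrite -(@sum_iid_square _ _ _ (fun y => l y - mu)) //; last first.
    by under eq_bigr do rewrite mulrBr; rewrite sumrB -mulr_suml q1 mul1r subrr.
  under eq_bigr do rewrite mulrDr mulrCA.
  by rewrite big_split /= -mulr_sumr -mulr_suml dq'.2 mul1r.
rewrite -EX; apply: (@le_trans _ _ (c ^+ t * \sum_ys q' ys * expR (- X ys))).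
  by rewrite ler_wpM2l ?exprn_ge0 ?(ltW c0) // jensen_expRN.
rewrite mulr_sumr; apply: ler_sum => ys _.
have sumL w : \sum_(k < t) w * l (ys k) = w * D ys + t%:R * (w * mu).
  rewrite -mulr_sumr /D sumrB sumr_const card_ord -mulr_natl; ring.
have prodE w : \prod_(k < t) (c * q (ys k) * expR (w * l (ys k))) =
    c ^+ t * (q' ys * expR (w * D ys + t%:R * (w * mu))).
  by rewrite !big_split /= prodr_const card_ord -expR_sum sumL -mulrA.
have Xle w : -1 <= w <= 1 -> 0 <= w * mu -> - X ys <= w * D ys + t%:R * (w * mu).
  move=> /andP[w1 w2] wmu.
  have tw : 0 <= t%:R * (w * mu) by rewrite mulr_ge0.
  suff : 0 <= X ys + w * D ys by lra.
  (* Completing the square; the remainder is nonnegative because [w] lies in [-1, 1]. *)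
  have -> : X ys + w * D ys =
      eta * (D ys + w / (2 * eta)) ^+ 2 + (1 - w ^+ 2) / (4 * eta).
    rewrite /X; field; exact: lt0r_neq0.
  apply: addr_ge0; first by rewrite mulr_ge0 ?sqr_ge0 // ltW.
  apply: divr_ge0; last by lra.
  have -> : 1 - w ^+ 2 = (1 - w) * (1 + w) by ring.
  by apply: mulr_ge0; lra.
have bound w (p : T -> R) : -1 <= w <= 1 -> 0 <= w * mu ->
    (forall y, c * q y * expR (w * l y) <= p y) ->
    c ^+ t * (q' ys * expR (- X ys)) <= \prod_(k < t) p (ys k).
  move=> w1 wmu wp.
  apply: (@le_trans _ _ (\prod_(k < t) (c * q (ys k) * expR (w * l (ys k))))).
    rewrite prodE ler_wpM2l ?exprn_ge0 ?(ltW c0) // ler_wpM2l ?dq'.1 //.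
    by rewrite ler_expR Xle.
  apply: ler_prod => k _.
  by rewrite wp mulr_ge0 ?expR_ge0 // mulr_ge0 // ltW.
rewrite le_min; apply/andP; split; first by apply: (bound (1 - s)) => //; lra.
by apply: (bound (- s)) => //; [lra | rewrite mulNr oppr_ge0].
Qed.

(** * Comparison of exponential rates *)

Lemma geometric_domination (R : realType) (K r c M : R) :
  0 < K -> 0 <= r -> r < c ->
  exists N : nat, forall t, (N <= t)%N -> M * r ^+ t < K * c ^+ t.
Proof.
move=> K0 r0 rc; have c0 := le_lt_trans r0 rc.
have rc1 : `|r / c| < 1.
  by rewrite ger0_norm ?divr_ge0 ?(ltW c0) // ltr_pdivrMr // mul1r.
have M0 : 0 < `|M| + 1 by rewrite ltr_wpDl.
have /cvgr0_norm_lt/(_ (K / (`|M| + 1))) := cvg_expr rc1.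
rewrite divr_gt0 // => /(_ isT)[N _ NP]; exists N => t Nt.
have := NP t Nt; rewrite /= ger0_norm ?exprn_ge0 ?divr_ge0 ?(ltW c0) //.
rewrite expr_div_n ltr_pdivrMr ?exprn_gt0 // mulrAC ltr_pdivlMr // mulrC.
apply: le_lt_trans; rewrite mulrDl mul1r.
apply: ler_wpDr; first exact: exprn_ge0.
by rewrite ler_wpM2r ?exprn_ge0 // ler_norm.
Qed.

(** With [eta] fixed, the lower bound is a constant times the [t]-th power of c exp(- eta v), so a
    small [eta] keeps the rate above [r]. *)
Lemma tilted_overlap_domination (R : realType) (T : finType) (q l p0 p1 : T -> R)
  (c s r M : R) (mu := \sum_y q y * l y) :
  is_dist q -> 0 <= s <= 1 -> s * mu <= 0 -> 0 <= (1 - s) * mu ->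
  (forall y, c * q y * expR ((1 - s) * l y) <= p0 y) ->
  (forall y, c * q y * expR (- s * l y) <= p1 y) -> 0 <= r -> r < c ->
  exists N : nat, forall t, (N <= t)%N ->
    M * r ^+ t < \sum_(ys : {ffun 'I_t -> T})
        Num.min (\prod_(k < t) p0 (ys k)) (\prod_(k < t) p1 (ys k)).
Proof.
move=> dq s01 smu smu' p0P p1P r0 rc; have c0 := le_lt_trans r0 rc.
set v := \sum_y q y * (l y - mu) ^+ 2.
have v0 : 0 <= v by apply: sumr_ge0 => y _; rewrite mulr_ge0 ?sqr_ge0 ?dq.1.
(* This choice gives c (1 - eta v) = r + eta c > r, and 1 - x <= exp(-x). *)
pose eta := (c - r) / (c * (v + 1)).
have cv0 : 0 < c * (v + 1) by rewrite mulr_gt0 // ltr_wpDl.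
have eta0 : 0 < eta by rewrite divr_gt0 // subr_gt0.
have etaE : eta * (c * (v + 1)) = c - r by rewrite divfK // gt_eqF.
have rlt : r < c * expR (- (eta * v)).
  have := ler_wpM2l (ltW c0) (expR_ge1Dx (- (eta * v))).
  have := mulr_gt0 eta0 c0; lra.
have K0 := expR_gt0 (- (4 * eta)^-1).
have [N NP] := geometric_domination M K0 r0 rlt.
exists N => t /NP Nt; apply: lt_le_trans Nt _.
apply: le_trans (tilted_overlap_ge t dq c0 s01 smu smu' p0P p1P eta0).
rewrite -/v opprD expRD exprMn -expRM_natl le_eqVlt; apply/orP; left; apply/eqP.
by rewrite mulrC -mulrA; congr (_ * (expR _ * _)); ring.
Qed.

Lemma continuous_expR_sum (R : realType) (T : finType) (k l : T -> R) :
  continuous (fun s : R => \sum_y k y * expR (s * l y)).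
Proof.
move=> s; apply: cvg_big => [|y _]; first exact: add_continuous.
apply: cvgM; first exact: cvg_cst.
apply: (@continuous_comp R R R (fun s => s * l y) expR); last exact: continuous_expR.
exact: mulrr_continuous.
Qed.

Lemma continuous_ge_unit_interval (R : realType) (f : R -> R) (r : R) :
  continuous f -> (forall s, 0 < s < 1 -> r <= f s) ->
  forall s, 0 <= s <= 1 -> r <= f s.
Proof.
move=> cf rf s /andP[s0 s1].
have [<-|s0'] := eqVneq 0 s.
  apply: (cvgr_to_ge (cvg_at_right_filter (cf 0))).
  near=> x; apply: rf; apply/andP; split; near: x.
    exact: nbhs_right_gt.
  exact: nbhs_right_lt.
have [->|s1'] := eqVneq s 1.
  apply: (cvgr_to_ge (cvg_at_left_filter (cf 1))).
  near=> x; apply: rf; apply/andP; split; near: x.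
    exact: nbhs_left_gt.
  exact: nbhs_left_lt.
by apply: rf; rewrite !lt_neqAle s0' s1' s0.
Unshelve. all: by end_near. Qed.

(* The first-order conditions for a minimum on [0, 1] of a function with
   derivative [g]. *)
Lemma unit_interval_critical_point (R : realType) (g : R -> R) :
  continuous g ->
  exists s, [/\ 0 <= s <= 1, s * g s <= 0 & 0 <= (1 - s) * g s].
Proof.
move=> cg.
have [g0|g0] := leP 0 (g 0).
  by exists 0; rewrite lexx ler01 mul0r subr0 mul1r.
have [g1|g1] := leP (g 1) 0.
  by exists 1; rewrite lexx ler01 subrr mul0r mul1r.
have [||s] := @IVT R g 0 1 0 ler01; first exact: continuous_subspaceT.
  by rewrite ge_min (ltW g0) le_max (ltW g1) orbT.
by rewrite in_itv /= => s01 gs; exists s; rewrite s01 gs !mulr0 lexx.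
Qed.

(** The Chernoff lower bound: tilting at a critical point [s] of [cs] gives the rate
    [cs s >= rho > r]. *)
Lemma overlap_iid_domination (R : realType) (Y : finType)
  (P : experiment R 'I_2 Y) (rho r M : R) :
  is_experiment P -> 0 <= r -> r < rho ->
  (forall s, 0 < s < 1 -> rho <= \sum_y P ord0 y `^ s * P ord_max y `^ (1 - s)) ->
  exists N : nat, forall t, (N <= t)%N -> M * r ^+ t < overlap (iid P t).
Proof.
move=> eP r0 rrho rhoP.
have P0 th y : 0 <= P th y by exact: (eP th).1.
(* Only signals possible in both states are kept; the others contribute nothing when [0 < s < 1]. *)
pose w y := if (0 < P ord0 y) && (0 < P ord_max y) then P ord_max y else 0.
pose l y := ln (P ord0 y) - ln (P ord_max y).
have w0 y : 0 <= w y by rewrite /w; case: ifP.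
pose cs s := \sum_y w y * expR (s * l y).
(* The derivative of [cs]. *)
pose g s := \sum_y (w y * l y) * expR (s * l y).
(* At the endpoints [powR] sends 0 to the power 0 to 1 and may count signals that [w] drops; hence
   the passage by continuity from the interior. *)
have rho_le s : 0 <= s <= 1 -> rho <= cs s.
  apply: continuous_ge_unit_interval; first exact: continuous_expR_sum.
  move=> {}s s01; have /andP[s0 s1] := s01.
  apply: le_trans (rhoP s s01) _; apply: ler_sum => y _; rewrite /w.
  have [Py0|Py0] := ltP 0 (P ord0 y); last first.
    have -> : P ord0 y = 0 by apply/eqP; rewrite eq_le Py0 P0.
    by rewrite powR0 ?gt_eqF // !mul0r.
  have [Py1|Py1] := ltP 0 (P ord_max y) => /=; last first.
    have -> : P ord_max y = 0 by apply/eqP; rewrite eq_le Py1 P0.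
    by rewrite powR0 ?subr_eq0 ?gt_eqF // mulr0 mul0r.
  rewrite /powR !gt_eqF // -{2}(lnK Py1) -!expRD ler_expR /l; lra.
have [s [s01 sg sg']] := unit_interval_critical_point
  (@continuous_expR_sum R Y (fun y => w y * l y) l).
have rc : r < cs s := lt_le_trans rrho (rho_le s s01).
have c0 := le_lt_trans r0 rc.
(* The law proportional to P(y|1)^s P(y|2)^(1-s) on the common support; under it [l] has mean
   [g s / cs s], whose sign is known. *)
pose q y := w y * expR (s * l y) / cs s.
have dq : is_dist q.
  split=> [y|]; first by rewrite divr_ge0 ?mulr_ge0 ?expR_ge0 // ltW.
  by rewrite -mulr_suml divff // gt_eqF.
have qE y : cs s * q y = w y * expR (s * l y) by rewrite mulrC divfK // gt_eqF.
have muE : \sum_y q y * l y = g s / cs s.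
  by rewrite mulr_suml; apply: eq_bigr => y _; rewrite /q; ring.
apply: (@tilted_overlap_domination R Y q l _ _ (cs s) s r M) => //.
- by rewrite muE mulrA pmulr_lle0 // invr_gt0.
- by rewrite muE mulrA pmulr_lge0 // invr_gt0.
- move=> y; rewrite qE -mulrA -expRD -mulrDl subrKC mul1r /w /l.
  case: ifP => [/andP[Py0 Py1]|]; last by rewrite mul0r.
  by rewrite expRD expRN !lnK // mulrC divfK // gt_eqF.
- move=> y; rewrite qE -mulrA -expRD -mulrDl subrr mul0r expR0 mulr1 /w.
  by case: ifP.
Qed.

(** [rho] is the exponential of the infimum for [P']; strictness supplies an [s] at which the sum
    for [P] falls below it. *)
Lemma chernoff_distance_ltP (R : realType) (Y Y' : finType)
  (P : experiment R 'I_2 Y) (P' : experiment R 'I_2 Y') :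
  is_experiment P' -> (chernoff_distance P' < chernoff_distance P)%E ->
  exists s rho, [/\ 0 <= s <= 1,
    \sum_y P ord0 y `^ s * P ord_max y `^ (1 - s) < rho &
    forall s', 0 <= s' <= 1 ->
      rho <= \sum_y P' ord0 y `^ s' * P' ord_max y `^ (1 - s')].
Proof.
move=> eP'; rewrite /chernoff_distance lteN2 => /ereal_inf_lt[_ [s s01 <-]].
set c := \sum_y _; set S := image _ _ => cS.
have c0 : 0 <= c by apply: sumr_ge0 => y _; rewrite mulr_ge0 ?powR_ge0.
have le_S s' : 0 <= s' <= 1 -> (ereal_inf S <=
    elog (\sum_y P' ord0 y `^ s' * P' ord_max y `^ (1 - s')))%E.
  by move=> s'01; apply: ereal_inf_lbound; exists s'.
(* At exponent 0 the sum is 1, which excludes an infimum equal to [+oo]; the value strictly below it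
   excludes [-oo]. *)
have := le_S 0; rewrite lexx ler01 => /(_ isT).
under eq_bigr do rewrite powRr0 mul1r subr0 powRr1 ?(eP' ord_max).1 //.
rewrite (eP' ord_max).2 /elog oner_eq0 ln1.
case: (ereal_inf S) cS le_S => [x| |] cS le_S //; last first.
  by move: cS; rewrite ltNge leNye.
move=> _.
exists s, (expR x); split=> // [|s' /le_S].
  rewrite -/c; move: cS; rewrite /elog.
  case: eqVneq => [-> _|c1]; first exact: expR_gt0.
  by rewrite lte_fin -ltr_expR lnK // posrE lt_neqAle eq_sym c1.
rewrite /elog; case: eqVneq => [_|c1]; first by rewrite leeNy_eq.
rewrite lee_fin -ler_expR lnK // posrE lt_neqAle eq_sym c1 sumr_ge0 // => y _.
by rewrite mulr_ge0 ?powR_ge0.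
Qed.

Theorem theorem4 (R : realType) (m : nat) (Y : 'I_m.+1 -> finType)
  (P : forall i : 'I_m.+1, experiment R 'I_2 (Y i)) :
  (forall i, is_experiment (P i)) ->
  (forall i : 'I_m.+1, i != ord0 -> (chernoff_distance (P i) < chernoff_distance (P ord0))%E) ->
  forall (A : finType) (u : 'I_2 -> A -> R), (0 < #|A|)%N ->
  exists tstar : nat, forall t : nat, (tstar <= t)%N ->
    Vjoint u (fun i : 'I_m.+1 => iid (P i) t) = V1 u (iid (P ord0) t).
Proof.
move=> eP wP A u A0; have [M MP] := Vjoint_eq_V1 u A0.
have /choice[N NP] : forall i : 'I_m.+1, exists N : nat, i != ord0 ->
    forall t, (N <= t)%N -> M * overlap (iid (P ord0) t) < overlap (iid (P i) t).
  move=> i; have [->|i0] := eqVneq i ord0; first by exists 0.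
  have [s [rho [s01 c_rho rho_le]]] := chernoff_distance_ltP (eP i) (wP i i0).
  set c := \sum_y _ in c_rho.
  have c0 : 0 <= c by apply: sumr_ge0 => y _; rewrite mulr_ge0 ?powR_ge0.
  (* The sign of [M] is unknown; with [|M|] the upper bound on the overlap can be multiplied
     through. *)
  have [s' s'01|N NP] :=
    @overlap_iid_domination _ _ (P i) rho c `|M| (eP i) c0 c_rho.
    by apply: rho_le; case/andP: s'01 => /ltW -> /ltW ->.
  exists N => _ t /NP; apply: le_lt_trans.
  apply: (@le_trans _ _ (`|M| * overlap (iid (P ord0) t))).
    rewrite ler_wpM2r ?ler_norm //; apply: sumr_ge0 => ys _.
    by rewrite le_min !(is_experiment_iid t (eP ord0) _).1.
  by rewrite ler_wpM2l // overlap_iid_le.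
exists (\max_i N i) => t Nt; apply: MP => [i|j j0].
  exact: is_experiment_iid.
apply: NP => //; apply: leq_trans Nt; exact: leq_bigmax.
Qed.
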